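(* The total energy $$E=\tfrac12\big(\dot\Gamma\times\Gamma+(\nu-b)\Gamma\big)^TJ\big(\dot\Gamma\times\Gamma+(\nu-b)\Gamma\big)-mg\,\rho^T\Gamma$$ is constant along motions of the Lagrange--Routh reduced equations for the 3D pendulum, i.e. along solutions $(\Gamma(t),\dot\Gamma(t))\in TS^2$ of $\ddot\Gamma=-\|\dot\Gamma\|^2\Gamma+\Gamma\times\Sigma$.
   Context: Here $J$ is the symmetric positive definite inertia matrix of the rigid body (body frame, origin at the pivot), $m,g>0$ are the mass and gravitational acceleration, $\rho\in\mathbb{R}^3$, $\rho\neq0$, is the body-fixed vector from the pivot to the center of mass, $\Gamma\in S^2$ is the gravity direction in the body frame, and $\mu\in\mathbb{R}$ is the fixed value of the momentum map (vertical component of angular momentum). In the reduced equation, $$\Sigma=b\dot\Gamma+J^{-1}\Big[\big(J(\dot\Gamma\times\Gamma)-bJ\Gamma\big)\times\big((\dot\Gamma\times\Gamma)-b\Gamma\big)+\nu^2J\Gamma\times\Gamma-mg\,\Gamma\times\rho-c\,\dot\Gamma\Big],$$ $$c=\nu\Big\{\mathrm{tr}[J]-2\tfrac{\|J\Gamma\|^2}{\Gamma\cdot J\Gamma}\Big\},\quad b=\frac{J\Gamma\cdot(\dot\Gamma\times\Gamma)}{\Gamma\cdot J\Gamma},\quad \nu=\frac{\mu}{\Gamma\cdot J\Gamma}.$$ *)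

(* Defs.v *)
From mathcomp Require Import all_boot all_order all_algebra.
From mathcomp Require Import all_classical all_reals all_analysis.
Import Order.TTheory GRing.Theory Num.Theory.
Import numFieldNormedType.Exports.

Set Implicit Arguments.
Unset Strict Implicit.
Unset Printing Implicit Defensive.

Local Open Scope classical_set_scope.
Local Open Scope ring_scope.

Section Pendulum.
Variable R : realType.
Implicit Types (J : 'M[R]_3) (u v G V rho : 'cV[R]_3) (m g mu : R).

Definition dot u v : R := (u^T *m v) 0 0.

(* The library norm `|u| on 'cV[R]_3 is the sup norm. *)
Definition enorm u : R := Num.sqrt (dot u u).

(* Indices are added modulo 3 in 'I_3. *)
Definition cross u v : 'cV[R]_3 :=
  \col_(i < 3) (u (i + 1) 0 * v (i + 2) 0 - u (i + 2) 0 * v (i + 1) 0).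

Definition symmetric_positive_definite J : Prop :=
  J^T = J /\ (forall u, u != 0 -> 0 < dot u (J *m u)).

(* Below, [G] is the gravity direction Gamma in the body frame and [V] is its
   time derivative. *)

Definition nu J mu G : R := mu / dot G (J *m G).

Definition b J G V : R := dot (J *m G) (cross V G) / dot G (J *m G).

Definition c J mu G : R :=
  nu J mu G * (\tr J - 2 * (enorm (J *m G) ^+ 2 / dot G (J *m G))).

Definition Sigma J m g rho mu G V : 'cV[R]_3 :=
  b J G V *: V +
  invmx J *m
    (cross (J *m cross V G - b J G V *: (J *m G)) (cross V G - b J G V *: G)
     + nu J mu G ^+ 2 *: cross (J *m G) G
     - (m * g) *: cross G rho
     - c J mu G *: V).

(* [w] is the angular velocity of the body reconstructed from the reduced
   state. *)
Definition energy J m g rho mu G V : R :=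
  let w := cross V G + (nu J mu G - b J G V) *: G in
  2^-1 * (w^T *m J *m w) 0 0 - m * g * (rho^T *m G) 0 0.

(* [derive1] is the two-sided derivative, so [I] is meant to be open.  The
   second and third clauses say that (Gamma, Gamma') lies in the tangent bundle
   of the unit sphere. *)
Definition routh_solution J m g rho mu (I : interval R)
    (Gamma : R -> 'cV[R]_3) : Prop :=
  forall t, t \in I ->
    [/\ derivable Gamma t 1 /\ derivable (derive1 Gamma) t 1,
        enorm (Gamma t) = 1,
        dot (Gamma t) (derive1 Gamma t) = 0 &
        derive1 (derive1 Gamma) t =
          - (enorm (derive1 Gamma t) ^+ 2 *: Gamma t)
          + cross (Gamma t) (Sigma J m g rho mu (Gamma t) (derive1 Gamma t))].

End Pendulum.

(* Main.v *)
(* Let W = Gamma' x Gamma + (nu - b) Gamma be the reconstructed angular velocity;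
   then Gamma' = Gamma x W and Gamma . J W = mu identically.  The reduced
   equation says that J W' = J W x W - m g Gamma x rho + k J Gamma for some
   scalar k.  Differentiating Gamma . J W = mu gives k (Gamma . J Gamma) = 0,
   so k = 0 and W obeys Euler's equation for the heavy rigid body, whence
   E' = W . J W' - m g rho . Gamma' = 0. *)
Require Import Defs.
From mathcomp Require Import all_boot all_order all_algebra.
From mathcomp Require Import all_classical all_reals all_analysis.
From mathcomp Require Import ring.
Import Order.TTheory GRing.Theory Num.Theory.
Import numFieldNormedType.Exports.

Set Implicit Arguments.
Unset Strict Implicit.
Unset Printing Implicit Defensive.

Local Open Scope classical_set_scope.
Local Open Scope ring_scope.

(** * Coordinates and cross-product identities in dimension three *)

Lemma forall_ord3 (P : 'I_3 -> Prop) : P 0 -> P 1 -> P 2 -> forall i, P i.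
Proof.
move=> P0 P1 P2 [[|[|[|//]]] lti].
- by rewrite (_ : Ordinal lti = 0)//; exact: val_inj.
- by rewrite (_ : Ordinal lti = 1)//; exact: val_inj.
- by rewrite (_ : Ordinal lti = 2)//; exact: val_inj.
Qed.

Lemma sum_ord3 (V : nmodType) (F : 'I_3 -> V) : \sum_i F i = F 0 + F 1 + F 2.
Proof.
rewrite !big_ord_recr big_ord0 /= add0r.
by congr (F _ + F _ + F _); exact: val_inj.
Qed.

Section VectorAlgebra.
Variable R : realType.
Implicit Types (J : 'M[R]_3) (u v w x : 'cV[R]_3) (k : R).

Lemma dotE u v : dot u v = u 0 0 * v 0 0 + u 1 0 * v 1 0 + u 2 0 * v 2 0.
Proof. by rewrite /dot mxE sum_ord3 !mxE. Qed.

Lemma mulmx3E J u i :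
  (J *m u) i 0 = J i 0 * u 0 0 + J i 1 * u 1 0 + J i 2 * u 2 0.
Proof. by rewrite mxE sum_ord3. Qed.

Lemma cross0E u v : cross u v 0 0 = u 1 0 * v 2 0 - u 2 0 * v 1 0.
Proof. by rewrite mxE !add0r. Qed.

Lemma cross1E u v : cross u v 1 0 = u 2 0 * v 0 0 - u 0 0 * v 2 0.
Proof.
have e2 : 1 + 1 = 2 :> 'I_3 by exact: val_inj.
have e0 : 1 + 2 = 0 :> 'I_3 by exact: val_inj.
by rewrite mxE e2 e0.
Qed.

Lemma cross2E u v : cross u v 2 0 = u 0 0 * v 1 0 - u 1 0 * v 0 0.
Proof.
have e0 : 2 + 1 = 0 :> 'I_3 by exact: val_inj.
have e1 : 2 + 2 = 1 :> 'I_3 by exact: val_inj.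
by rewrite mxE e0 e1.
Qed.

Lemma col3P u v : u 0 0 = v 0 0 -> u 1 0 = v 1 0 -> u 2 0 = v 2 0 -> u = v.
Proof.
move=> e0 e1 e2; apply/matrixP => i j; rewrite ord1; move: i.
exact: forall_ord3.
Qed.

Definition mxE3 := (dotE, mulmx3E, cross0E, cross1E, cross2E).

Ltac col3_ring := apply: col3P; rewrite ?(mxE3, mxE); ring.

Lemma dotC u v : dot u v = dot v u.
Proof. by rewrite !dotE; ring. Qed.

Lemma dotDr u v w : dot u (v + w) = dot u v + dot u w.
Proof. by rewrite !dotE !mxE; ring. Qed.

Lemma dotZr k u v : dot u (k *: v) = k * dot u v.
Proof. by rewrite !dotE !mxE; ring. Qed.

Lemma dot_crossl u v : dot u (cross u v) = 0.
Proof. by rewrite !mxE3; ring. Qed.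

Lemma dot_crossr u v : dot v (cross u v) = 0.
Proof. by rewrite !mxE3; ring. Qed.

Lemma dot_cross_rot u v w : dot u (cross v w) = dot v (cross w u).
Proof. by rewrite !mxE3; ring. Qed.

Lemma crossNC u v : cross u v = - cross v u.
Proof. by col3_ring. Qed.

Lemma crossDl u v w : cross (u + v) w = cross u w + cross v w.
Proof. by col3_ring. Qed.

Lemma crossDr u v w : cross u (v + w) = cross u v + cross u w.
Proof. by col3_ring. Qed.

Lemma crossZl k u v : cross (k *: u) v = k *: cross u v.
Proof. by col3_ring. Qed.

Lemma crossZr k u v : cross u (k *: v) = k *: cross u v.
Proof. by col3_ring. Qed.

Lemma crossvv u : cross u u = 0.
Proof. by col3_ring. Qed.

Lemma cross_cross u v w : cross u (cross v w) = dot u w *: v - dot u v *: w.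
Proof. by col3_ring. Qed.

(** First-order part in [e] of the cofactor identity Mu × Mv = cof(M)(u × v) for M = 1 + eJ. It
    accounts for the trace term in [c]. *)
Lemma cross_mulmx J u v :
  cross (J *m u) v + cross u (J *m v) + J^T *m cross u v = \tr J *: cross u v.
Proof.
by rewrite /mxtrace sum_ord3; col3_ring.
Qed.

Lemma dot_mulmx_sym J u v : J^T = J -> dot u (J *m v) = dot v (J *m u).
Proof.
by move=> Jsym; rewrite dotC /dot trmx_mul Jsym -mulmxA.
Qed.

Lemma enorm2 u : enorm u ^+ 2 = dot u u.
Proof. by rewrite sqr_sqrtr// dotE -!expr2 !addr_ge0 ?sqr_ge0. Qed.

End VectorAlgebra.

(** * Product rules for vector-valued functions *)

Section Derivatives.
Variables (R : realType) (V : normedModType R).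

Lemma is_derive_mxP m n (M : V -> 'M[R]_(m, n)) dM t v :
  is_derive t v M dM <-> forall i j, is_derive t v (fun x => M x i j) (dM i j).
Proof.
split=> [[Mt <-] i j|dMt].
  rewrite derive_mx// mxE; apply: DeriveDef => //.
  by move/derivable_mxP: Mt.
have Mt : derivable M t v.
  by apply/derivable_mxP => i j; have [] := dMt i j.
apply: DeriveDef => //; rewrite derive_mx//; apply/matrixP => i j.
by rewrite mxE; have [] := dMt i j.
Qed.

Lemma is_derive_mulmx m n p (M : V -> 'M[R]_(m, n)) (N : V -> 'M[R]_(n, p))
    dM dN t v :
  is_derive t v M dM -> is_derive t v N dN ->
  is_derive t v (fun x => M x *m N x) (dM *m N t + M t *m dN).
Proof.
move=> /is_derive_mxP dMt /is_derive_mxP dNt; apply/is_derive_mxP => i j.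
have -> : (fun x => (M x *m N x) i j) =
    \sum_(k < n) ((fun x => M x i k) * (fun x => N x k j)).
  by apply/funext => x; rewrite mxE fct_sumE.
apply: is_derive_eq; rewrite !mxE -big_split; apply: eq_bigr => k _ /=.
by rewrite /GRing.scale /=; ring.
Qed.

Lemma is_derive_dot (u w : V -> 'cV[R]_3) du dw t v :
  is_derive t v u du -> is_derive t v w dw ->
  is_derive t v (fun x => dot (u x) (w x)) (dot du (w t) + dot (u t) dw).
Proof.
move=> du_ dw_.
have duT : is_derive t v (fun x => (u x)^T) du^T.
  apply/is_derive_mxP => i j; move/is_derive_mxP : du_ => /(_ j i).
  by rewrite mxE; under [in X in _ -> X]eq_fun do rewrite mxE.
have /is_derive_mxP/(_ 0 0) := is_derive_mulmx duT dw_.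
by rewrite mxE.
Qed.

Lemma is_derive_cross (u w : V -> 'cV[R]_3) du dw t v :
  is_derive t v u du -> is_derive t v w dw ->
  is_derive t v (fun x => cross (u x) (w x)) (cross du (w t) + cross (u t) dw).
Proof.
move=> /is_derive_mxP du_ /is_derive_mxP dw_; apply/is_derive_mxP => i j.
have -> : (fun x => cross (u x) (w x) i j) =
    (fun x => u x (i + 1) 0) * (fun x => w x (i + 2) 0)
    - (fun x => u x (i + 2) 0) * (fun x => w x (i + 1) 0).
  by apply/funext => x; rewrite mxE.
by apply: is_derive_eq; rewrite !mxE /GRing.scale /=; ring.
Qed.

Lemma is_derive_scale (k : V -> R) (u : V -> 'cV[R]_3) dk du t v :
  is_derive t v k dk -> is_derive t v u du ->
  is_derive t v (fun x => k x *: u x) (dk *: u t + k t *: du).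
Proof.
move=> dk_ /is_derive_mxP du_; apply/is_derive_mxP => i j.
have -> : (fun x => (k x *: u x) i j) = k * (fun x => u x i j).
  by apply/funext => x; rewrite mxE.
by apply: is_derive_eq; rewrite !mxE /GRing.scale /=; ring.
Qed.

End Derivatives.

(** * Algebra of the reduced equation at a single state *)

Section RouthDynamics.
Variables (R : realType) (J : 'M[R]_3) (m g mu : R) (rho : 'cV[R]_3).
Hypothesis J_spd : symmetric_positive_definite J.

Let Jsym : J^T = J. Proof. by case: J_spd. Qed.

Let Jsymdot u v : dot u (J *m v) = dot v (J *m u).
Proof. exact: dot_mulmx_sym. Qed.

(** A nonzero kernel vector would annihilate the positive quadratic form. *)
Lemma spd_unitmx : J \in unitmx.
Proof.
case: J_spd => _ Jpos; rewrite unitmxE unitfE; apply/det0P => -[u u0 uJ0].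
have /Jpos : u^T != 0 by rewrite trmx_eq0.
by rewrite /dot trmxK mulmxA uJ0 mul0mx mxE ltxx.
Qed.

Section State.
Variables G V : 'cV[R]_3.
Hypotheses (G_unit : dot G G = 1) (GV0 : dot G V = 0).

Let D := dot G (J *m G).
(** The splitting w = a + nu G isolates the part [a] without vertical momentum: [b] is chosen so
    that JG · a = 0. *)
Let a := cross V G - b J G V *: G.
Let w := cross V G + (nu J mu G - b J G V) *: G.

Lemma inertia_neq0 : D != 0.
Proof.
rewrite gt_eqF//; case: J_spd => _; apply; apply/eqP => G0.
by move: G_unit; rewrite G0 /dot mulmx0 mxE => /esym/eqP; rewrite oner_eq0.
Qed.

Let wE : w = a + nu J mu G *: G.
Proof. by rewrite /w scalerBl addrCA addrC -addrA [- _ + _]addrC. Qed.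

(** Crossing with [G] loses the [G] term of [w], and G × (V × G) = V for unit [G] and orthogonal
    [V]. *)
Lemma cross_angular_velocity : cross G w = V.
Proof.
rewrite crossDr crossZr crossvv scaler0 addr0 cross_cross G_unit GV0.
by rewrite scale1r scale0r subr0.
Qed.

(** The [b] term cancels the vertical momentum of V × G, and nu G carries exactly [mu]. *)
Lemma vertical_momentum : dot G (J *m w) = mu.
Proof.
rewrite mulmxDr -scalemxAr dotDr dotZr Jsymdot dotC mulrBl /nu /b -/D.
by rewrite !divfK ?inertia_neq0// addrC subrK.
Qed.

Let crossGa : cross G a = V.
Proof.
by rewrite -cross_angular_velocity wE crossDr crossZr crossvv scaler0 addr0.
Qed.

Let dotJGa : dot (J *m G) a = 0.
Proof.
rewrite dotDr -scaleNr dotZr [dot _ G]dotC -/D /b -/D mulNr.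
by rewrite divfK ?inertia_neq0// subrr.
Qed.

(* As [a] is orthogonal to [J *m G] and [cross G a = V], expanding
   [cross (J *m G) (cross G a)] expresses [a] through [V]. *)
Lemma cross_inertia :
  cross (J *m G) a = (enorm (J *m G) ^+ 2 / D) *: V
                     - (dot (J *m G) V / D) *: (J *m G).
Proof.
have D0 := inertia_neq0.
have e : D *: a = - cross (J *m G) V.
  rewrite -[in RHS]crossGa cross_cross dotJGa scale0r sub0r opprK.
  by rewrite dotC.
apply: (scalerI D0); rewrite -crossZr e -scaleN1r crossZr cross_cross enorm2.
by rewrite scaleN1r opprB scalerBr !scalerA ![D * _]mulrC !divfK.
Qed.

(* The left-hand side is J W' up to a multiple of [J *m G], where [W = w] is the
   angular velocity along a motion. *)
Lemma routh_momentum_balance : exists k,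
  J *m (Sigma J m g rho mu G V + (nu J mu G - b J G V) *: V) =
  cross (J *m w) w - (m * g) *: cross G rho + k *: (J *m G).
Proof.
(* The JG term left over when (‖JG‖²/D) V inside [c] times [V] is traded for JG × a. *)
exists (2 * nu J mu G * (dot (J *m G) V / D)).
have VE : cross a G = - V by rewrite crossNC crossGa.
(* The trace identity for [a] and [G], with a × G = -V, trades Ja × G for JG × a, so that the mixed
   terms of Jw × w contain 2 JG × a. *)
have JV : cross (J *m a) G =
    J *m V - \tr J *: V + cross (J *m G) a.
  have := cross_mulmx J a G; rewrite Jsym VE mulmxN scalerN.
  rewrite [cross a _]crossNC => h.
  rewrite [- (\tr J *: V)](esym h).
  move: (cross (J *m a) G) (cross (J *m G) a) (J *m V) => x y z.
  by apply/matrixP => i j; rewrite !mxE; ring.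
have Jww : cross (J *m w) w = cross (J *m a) a
    + nu J mu G *: (cross (J *m a) G + cross (J *m G) a)
    + nu J mu G ^+ 2 *: cross (J *m G) G.
  rewrite wE mulmxDr -scalemxAr !(crossDl, crossDr, crossZl, crossZr).
  move: (cross (J *m a) a) (cross (J *m a) G) (cross _ _) (cross _ G).
  move=> x y z t.
  by apply/matrixP => i j; rewrite !mxE; ring.
(* The first cross product in [Sigma] is Ja × a. *)
have JSigma : J *m Sigma J m g rho mu G V = b J G V *: (J *m V)
    + (cross (J *m a) a + nu J mu G ^+ 2 *: cross (J *m G) G
       - (m * g) *: cross G rho - c J mu G *: V).
  rewrite /Sigma mulmxDr mulmxA mulmxV ?spd_unitmx// mul1mx -scalemxAr.
  by rewrite /a mulmxBr -scalemxAr.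
have cV : c J mu G *: V = nu J mu G *: (\tr J *: V
    - 2 *: (cross (J *m G) a + (dot (J *m G) V / D) *: (J *m G))).
  rewrite cross_inertia subrK /c -/D.
  by apply/matrixP => i j; rewrite !mxE; ring.
rewrite Jww JV mulmxDr JSigma cV -scalemxAr.
move: (dot _ _ / D) (cross (J *m a) a) (cross (J *m G) a) (cross (J *m G) G).
move=> r x y z.
move: (nu J mu G) (b J G V) (cross G rho) (J *m V) (J *m G) (\tr J).
move=> n k p q s tr.
by apply/matrixP => i j; rewrite !mxE; ring.
Qed.

End State.
End RouthDynamics.

(** Mean value theorem on the segment between the two points, which lies in [I] by convexity. *)
Lemma is_derive0_itv_cst (R : realType) (f : R -> R) (I : interval R) :
  (forall x, x \in I -> is_derive x 1 f 0) -> {in I &, forall s t, f s = f t}.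
Proof.
move=> f'0; suff le_cst s t : s \in I -> t \in I -> s <= t -> f s = f t.
  by move=> s t sI tI; case: (leP s t) => [|/ltW] st;
    [|apply/esym]; exact: le_cst.
move=> sI tI st.
have stI x : x \in `[s, t] -> x \in I.
  by rewrite in_itv /=; exact: (interval_is_interval sI tI).
have f'0_st x : x \in `]s, t[ -> is_derive x 1 f 0.
  by move=> xst; apply/f'0/stI/(subset_itv_oo_cc xst).
have cf : {within `[s, t], continuous f}.
  by apply: derivable_within_continuous => x /stI xI; case: (f'0 x xI).
have [x _] := MVT_segment st f'0_st cf.
by rewrite mul0r => /eqP; rewrite subr_eq0 => /eqP.
Qed.

(** * Euler's equation and energy balance along a motion *)

Section RouthMotion.
Variables (R : realType) (J : 'M[R]_3) (m g mu : R) (rho : 'cV[R]_3).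
Variables (I : interval R) (Gamma : R -> 'cV[R]_3).
Hypotheses (J_spd : symmetric_positive_definite J) (I_open : open [set` I]).
Hypothesis Gamma_sol : routh_solution J m g rho mu I Gamma.

Let k s := nu J mu (Gamma s) - b J (Gamma s) (derive1 Gamma s).
Let W s := cross (derive1 Gamma s) (Gamma s) + k s *: Gamma s.

Lemma routh_solution_unit t : t \in I -> dot (Gamma t) (Gamma t) = 1.
Proof. by case/Gamma_sol => _ G1 _ _; rewrite -enorm2 G1 expr1n. Qed.

Section AtTime.
Variable t : R.
Hypothesis tI : t \in I.

Let G := Gamma t.
Let V := derive1 Gamma t.

Let G_unit : dot G G = 1. Proof. exact: routh_solution_unit. Qed.
Let GV0 : dot G V = 0. Proof. by case: (Gamma_sol tI). Qed.

Let dG : is_derive t 1 Gamma V.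
Proof.
by case: (Gamma_sol tI) => -[? _] _ _ _; rewrite /V derive1E; exact: derivableP.
Qed.

Let dV : is_derive t 1 (derive1 Gamma) (derive1 (derive1 Gamma) t).
Proof.
by case: (Gamma_sol tI) => -[_ ?] _ _ _; rewrite derive1E; exact: derivableP.
Qed.

Let dJ (u : R -> 'cV[R]_3) du :
  is_derive t 1 u du -> is_derive t 1 (fun s => J *m u s) (J *m du).
Proof.
move=> du_; rewrite -[J *m du]add0r -(mul0mx _ (u t)).
by apply: is_derive_mulmx; exact: is_derive_cst.
Qed.

(** Both quotients in [k] have a denominator that is nonzero at [t]. The value of k' stays implicit,
    since it enters W' only as a multiple of Gamma. *)
Lemma derivable_spin : derivable k t 1.
Proof.
have [dD _] := is_derive_dot dG (dJ dG).
have [dN _] := is_derive_dot (dJ dG) (is_derive_cross dV dG).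
have dDV := @derivableV _ _ (fun s => dot (Gamma s) (J *m Gamma s)) _ _
  (inertia_neq0 J_spd G_unit) dD.
exact: derivableB (derivableM (derivable_cst mu _ _) dDV) (derivableM dN dDV).
Qed.

(** In Gamma'' × Gamma the centripetal term drops out, and (G × S) × G = S - (G · S) G for unit [G];
    this last term and k' make up [l]. *)
Lemma is_derive_angular_velocity : exists l,
  is_derive t 1 W (Sigma J m g rho mu G V + k t *: V + l *: G).
Proof.
have dk := derivableP derivable_spin.
exists ('D_1 k t - dot G (Sigma J m g rho mu G V)).
have := is_deriveD (is_derive_cross dV dG) (is_derive_scale dk dG).
move/is_derive_eq; apply.
case: (Gamma_sol tI) => _ _ _ ->.
rewrite crossvv addr0 crossDl -scaleNr crossZl crossvv scaler0 add0r.
rewrite crossNC cross_cross -/G -/V G_unit scale1r.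
move: (Sigma _ _ _ _ _ _ _) => S.
by apply/matrixP => i j; rewrite !mxE; ring.
Qed.

Lemma is_derive_angular_momentum :
  exists2 dW, is_derive t 1 W dW &
    J *m dW = cross (J *m W t) (W t) - (m * g) *: cross G rho.
Proof.
have [l dW] := is_derive_angular_velocity.
exists (Sigma J m g rho mu G V + k t *: V + l *: G) => //.
have [n balance] := routh_momentum_balance m g mu rho J_spd G_unit GV0.
set dw := _ + _ in dW *.
(* The leftovers [n] of the momentum balance and [l] of W' merge into one multiple of JG. *)
have JdW : J *m dw = cross (J *m W t) (W t) - (m * g) *: cross G rho
    + (n + l) *: (J *m G).
  by rewrite mulmxDr balance -scalemxAr scalerDl addrA.
(* The vertical momentum equals [mu] throughout [I], hence near [t] because [I] is open, so its
   derivative vanishes. *)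
have dmom : dot V (J *m W t) + dot G (J *m dw) = 0.
  have /@derive_val <- := is_derive_dot dG (dJ dW).
  rewrite -(derive_cst mu t 1); apply: near_eq_derive.
  apply: filterS (open_nbhs_nbhs (conj I_open tI)) => s sI.
  by apply: vertical_momentum => //; exact: routh_solution_unit.
(* Conservation of the vertical momentum kills the undetermined multiple. *)
rewrite JdW; suff -> : n + l = 0 by rewrite scale0r addr0.
apply/(mulIf (inertia_neq0 J_spd G_unit)); rewrite mul0r -dmom -/G.
rewrite JdW !dotDr -scaleNr !dotZr dot_crossl mulr0 addr0.
(* G · (JW × W) = JW · (W × G) = -JW · V cancels the term V · JW. *)
rewrite [dot G (cross _ _)]dot_cross_rot crossNC.
rewrite cross_angular_velocity//.
by rewrite -scaleN1r dotZr mulN1r [dot V _]dotC addrA subrr add0r.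
Qed.

Lemma is_derive_energy :
  is_derive t 1 (fun s => energy J m g rho mu (Gamma s) (derive1 Gamma s)) 0.
Proof.
have [dW dW_ JdW] := is_derive_angular_momentum.
have -> : (fun s => energy J m g rho mu (Gamma s) (derive1 Gamma s)) =
    2^-1 \*: (fun s => dot (W s) (J *m W s))
    - (m * g) \*: (fun s => dot rho (Gamma s)).
  by apply/funext => s; rewrite /energy -mulmxA.
have drho := is_derive_dot (is_derive_cst rho t 1) dG.
have dT := is_derive_dot dW_ (dJ dW_).
have := is_deriveB (is_deriveZ 2^-1 dT) (is_deriveZ (m * g) drho).
move/is_derive_eq; apply.
(* The gyroscopic torque JW × W does no work, and -W · (G × rho) = rho · (G × W) = rho · V. *)
have power : dot (W t) (J *m dW) = m * g * dot rho V.
  rewrite JdW dotDr dot_crossr add0r -scaleNr dotZr.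
  rewrite dot_cross_rot dot_cross_rot crossNC cross_angular_velocity//.
  by rewrite -[- derive1 _ _]scaleN1r dotZr; ring.
(* By symmetry of [J] the two halves of the kinetic derivative coincide, absorbing the factor
   1/2. *)
rewrite (dot_mulmx_sym dW (W t)) ?power; last by case: J_spd.
rewrite /GRing.scale /= [dot 0 _]dotE !mxE.
by field.
Qed.

End AtTime.
End RouthMotion.

Theorem proposition19 (R : realType) (J : 'M[R]_3) (m g mu : R)
    (rho : 'cV[R]_3) (I : interval R) (Gamma : R -> 'cV[R]_3)
    (J_spd : symmetric_positive_definite J)
    (m_gt0 : 0 < m) (g_gt0 : 0 < g) (rho_neq0 : rho != 0)
    (I_open : open [set` I])
    (Gamma_sol : routh_solution J m g rho mu I Gamma) :
  forall s t : R, s \in I -> t \in I ->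
    energy J m g rho mu (Gamma s) (derive1 Gamma s) =
    energy J m g rho mu (Gamma t) (derive1 Gamma t).
Proof.
exact: (is_derive0_itv_cst (is_derive_energy J_spd I_open Gamma_sol)).
Qed.
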